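(* Let $K_1(n)$ denote the number of partitions of $n$ into parts $\equiv\pm1,\pm18,\pm20$ or $\pm38\pmod{76}$ such that the parts $\equiv\pm1$ and $\pm38\pmod{76}$ have $2$ colors. Let $K_2(n)$ denote the number of partitions of $n$ into parts $\equiv\pm18,\pm20,\pm37$ or $\pm38\pmod{76}$ such that the parts $\equiv\pm37$ and $\pm38\pmod{76}$ have $2$ colors. Let $K_3(n)$ denote the number of partitions of $n$ into parts $\equiv\pm1,\pm19$ and $\pm37\pmod{76}$, each part having $2$ colors. Here $+38$ and $-38$ are counted as two separate residues (although they coincide modulo $76$), so that parts $\equiv 38\pmod{76}$ occur in $4$ colors in total in $K_1$ and in $K_2$. Then for every integer $n\ge18$, $$K_1(n)-K_2(n-18)-K_3(n)=0.$$
   Context: A part in a partition has $r$ colors if there are $r$ copies of each such part, all viewed as distinct objects; parts for which no number of colors is specified have one color. Partitions are unordered, and each of the counting functions equals $1$ at $n=0$. With $(\lambda;q)_\infty=\prod_{j\ge0}(1-\lambda q^j)$, $(\lambda_1,\dots,\lambda_s;q)_\infty=\prod_{j}(\lambda_j;q)_\infty$ and the convention $(q^{r\pm};q^t)_\infty:=(q^r,q^{t-r};q^t)_\infty$ for $0<r<t$ (so $(q^{38\pm};q^{76})_\infty=(q^{38};q^{76})_\infty^2$), and $(q^{r_1\pm},\dots,q^{r_s\pm};q^t)_\infty:=\prod_j (q^{r_j\pm};q^t)_\infty$, the generating functions are $$\sum_{n\ge0}K_1(n)q^n=\frac{1}{(q^{18\pm},q^{20\pm};q^{76})_\infty(q^{1\pm},q^{38\pm};q^{76})_\infty^2},$$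 $$\sum_{n\ge0}K_2(n)q^n=\frac{1}{(q^{18\pm},q^{20\pm};q^{76})_\infty(q^{37\pm},q^{38\pm};q^{76})_\infty^2},$$ $$\sum_{n\ge0}K_3(n)q^n=\frac{1}{(q^{1\pm},q^{19\pm},q^{37\pm};q^{76})_\infty^2}.$$ *)

(* Defs.v *)
From mathcomp Require Import all_boot.

Set Implicit Arguments.
Unset Strict Implicit.
Unset Printing Implicit Defensive.

(* For [c : nat -> nat], the part [k] comes in [c k] colors.  A colored part of
   size at most [n] is a pair of [i : 'I_n], standing for the size [i.+1], and a
   color in ['I_(c i.+1)]. *)
Definition colored_part (c : nat -> nat) (n : nat) : finType :=
  {i : 'I_n & 'I_(c i.+1)}.

Definition part_size (c : nat -> nat) (n : nat) (x : colored_part c n) : nat :=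
  (tag x).+1.

(* An (unordered) colored partition of [n] is a multiset of colored parts with
   total size [n], given by its multiplicity function.  Neither the sizes nor
   the multiplicities can exceed [n], so the bounds lose nothing. *)
Definition colored_partitions (c : nat -> nat) (n : nat) :
    {set {ffun colored_part c n -> 'I_n.+1}} :=
  [set m : {ffun colored_part c n -> 'I_n.+1} |
    \sum_(x : colored_part c n) m x * part_size x == n].

Definition num_colored_partitions (c : nat -> nat) (n : nat) : nat :=
  #|colored_partitions c n|.

(* [s] lists pairs [(r, m)], meaning that parts congruent to [r] or to [- r]
   modulo [t] have [m] colors.  The residues [r] and [- r] contribute
   separately, even when they coincide modulo [t] (as for r = 38, t = 76). *)
Definition pm_colors (t : nat) (s : seq (nat * nat)) (k : nat) : nat :=
  \sum_(rm <- s) rm.2 * ((k == rm.1 %[mod t]) + (k + rm.1 == 0 %[mod t])).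

Definition K1 : nat -> nat :=
  num_colored_partitions (pm_colors 76 [:: (1, 2); (18, 1); (20, 1); (38, 2)]).

Definition K2 : nat -> nat :=
  num_colored_partitions (pm_colors 76 [:: (18, 1); (20, 1); (37, 2); (38, 2)]).

Definition K3 : nat -> nat :=
  num_colored_partitions (pm_colors 76 [:: (1, 2); (19, 2); (37, 2)]).

(* Main.v *)
(* Write th(r) for (q^{r+-}; q^76)_oo.  After clearing denominators the claim is
       th(37)^2 th(19)^2 - q^18 th(1)^2 th(19)^2 = th(18) th(20) th(38)^2.
   By the Jacobi triple product, th(37)^2 and q^18 th(1)^2 are, up to a common
   factor, the sums of (-1)^s q^(19(s^2 + d^2) + s) over the integers s, d of
   equal parity, and minus that over s, d of opposite parity.  The difference is
   therefore the full sum, which factors as a sum over s times a sum over d; the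
   triple product turns these back into products.  Power series in q are
   represented by polynomials modulo X^N, and the triple product is obtained
   from the finite q-binomial theorem. *)
Require Import Defs.
From mathcomp Require Import all_boot all_order all_algebra.
From mathcomp Require Import ring zify.
From Stdlib Require Import Setoid Morphisms.
Set Implicit Arguments.
Unset Strict Implicit.
Unset Printing Implicit Defensive.

Import Order.TTheory GRing.Theory Num.Theory.
Local Open Scope ring_scope.

(** * Congruence of polynomials modulo a power of ['X] *)

(* A [Variant] rather than a [Definition]: otherwise [rewrite] would unfold it
   to an equation between coefficients. *)
Variant eqmodXn {R : comNzRingType} (N : nat) (p q : {poly R}) : Prop :=
  EqmodXn of forall i, (i < N)%N -> p`_i = q`_i.

Notation "p = q '%[modX' N ]" := (eqmodXn N p q)
  (at level 70, q at next level, format "p  =  q  %[modX  N ]").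

Global Instance eqmodXn_equiv {R : comNzRingType} (N : nat) :
  Equivalence (@eqmodXn R N).
Proof.
split=> [p // | p q [pq] | p q r [pq] [qr]]; split=> i lti //; first by rewrite pq.
by rewrite pq ?qr.
Qed.

Lemma eq_eqmodXn {R : comNzRingType} (N : nat) (p q : {poly R}) :
  p = q -> p = q %[modX N].
Proof. by move->. Qed.

Global Instance eqmodXn_add {R : comNzRingType} (N : nat) :
  Proper (@eqmodXn R N ==> @eqmodXn R N ==> @eqmodXn R N) +%R.
Proof. by move=> p p' [pp] q q' [qq]; split=> i lti; rewrite !coefD pp ?qq. Qed.

Global Instance eqmodXn_opp {R : comNzRingType} (N : nat) :
  Proper (@eqmodXn R N ==> @eqmodXn R N) -%R.
Proof. by move=> p p' [pp]; split=> i lti; rewrite !coefN pp. Qed.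

Global Instance eqmodXn_mul {R : comNzRingType} (N : nat) :
  Proper (@eqmodXn R N ==> @eqmodXn R N ==> @eqmodXn R N) *%R.
Proof.
move=> p p' [pp] q q' [qq]; split=> i lti; rewrite !coefM; apply: eq_bigr => j _.
by rewrite pp ?qq // (leq_ltn_trans _ lti) ?leq_subr // -ltnS.
Qed.

Global Instance eqmodXn_exp {R : comNzRingType} (N : nat) :
  Proper (@eqmodXn R N ==> eq ==> @eqmodXn R N) (@GRing.exp _).
Proof.
move=> p p' pp k _ <-; elim: k => [|k IHk]; first by rewrite !expr0.
by rewrite !exprS; apply: eqmodXn_mul.
Qed.

Lemma eqmodXn_le {R : comNzRingType} (M N : nat) (p q : {poly R}) :
  (M <= N)%N -> p = q %[modX N] -> p = q %[modX M].
Proof. by move=> leMN [pq]; split=> i ltiM; apply: pq; apply: leq_trans leMN. Qed.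

(** Multiplication by ['X^k] gains [k] orders of precision. In the triple product this makes up for
    the q-binomials being less precise away from the middle of their row. *)
Lemma eqmodXn_mulXn {R : comNzRingType} (N k : nat) (p q : {poly R}) :
  p = q %[modX N - k] -> 'X^k * p = 'X^k * q %[modX N].
Proof.
move=> [pq]; split=> i ltiN; rewrite !coefXnM; case: ltnP => // leki.
by apply: pq; lia.
Qed.

Lemma eqmodXn_Xn0 {R : comNzRingType} (N k : nat) :
  (N <= k)%N -> ('X^k : {poly R}) = 0 %[modX N].
Proof. by move=> leNk; split=> i lti; rewrite coefXn coef0 ltn_eqF // (leq_trans lti). Qed.

Lemma eqmodXn_sum {R : comNzRingType} (N : nat) (I : eqType) (r : seq I)
    (P : pred I) (F G : I -> {poly R}) :
  (forall i, i \in r -> P i -> F i = G i %[modX N]) ->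
  \sum_(i <- r | P i) F i = \sum_(i <- r | P i) G i %[modX N].
Proof.
move=> FG; rewrite big_seq_cond [X in eqmodXn _ _ X]big_seq_cond.
elim/big_ind2: _ => // [p p' q q' pp qq | i /andP[ri Pi]]; last exact: FG.
by rewrite pp qq.
Qed.

(** Strong induction on the index: coefficient [i] of [p * q] is that of [q] plus terms in lower
    coefficients of [q]. *)
Lemma eqmodXn_mul2l {R : comNzRingType} (N : nat) (p q r : {poly R}) :
  p`_0 = 1 -> p * q = p * r %[modX N] -> q = r %[modX N].
Proof.
move=> p0 [pqr]; split; elim/ltn_ind => i IHi ltiN.
have := pqr i ltiN; rewrite !coefM !big_ord_recl subn0 p0 !mul1r.
set s := \sum_(j < i) _; set s' := \sum_(j < i) _; suff -> : s = s' by move/addIr.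
apply: eq_bigr => j _; rewrite IHi //; rewrite lift0; have := ltn_ord j; lia.
Qed.

Lemma eqmodXn_prod_trunc {R : comNzRingType} (N m m' : nat)
    (f : nat -> {poly R}) :
    (m <= m')%N -> (forall k, (m <= k < m')%N -> f k = 1 %[modX N]) ->
  \prod_(k < m') f k = \prod_(k < m) f k %[modX N].
Proof.
elim: m' => [|m' IHm']; first by rewrite leqn0 => /eqP->.
rewrite leq_eqVlt => /predU1P[-> // | ltmm'] f1.
rewrite big_ord_recr /= (f1 m'); last by lia.
rewrite mulr1; apply: IHm' => // k /andP[lemk ltk].
by apply: f1; rewrite lemk ltnW.
Qed.

(** * Generating functions *)

Lemma prod_part_sizeE (c : nat -> nat) (n : nat) :
  \prod_(x : colored_part c n) (1 - 'X^(part_size x)) =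
  \prod_(k < n) (1 - 'X^(k.+1)) ^+ c k.+1 :> {poly int}.
Proof.
rewrite -(@sig_big_dep _ _ _ _ (fun i : 'I_n => 'I_(c i.+1)) xpredT
  (fun _ _ => true) (fun i _ => 1 - 'X^(i.+1))) /=.
by apply: eq_bigr => i _; rewrite prodr_const card_ord.
Qed.

(** Expanding the product picks one exponent [j] for each colored part, that is, a multiplicity
    function, which contributes ['X] to the power of its total size. *)
Lemma num_colored_partitions_coef (c : nat -> nat) (n : nat) :
  (num_colored_partitions c n)%:Z =
  (\prod_(x : colored_part c n) \sum_(j < n.+1) 'X^(j * part_size x))`_n.
Proof.
rewrite bigA_distr_bigA coef_sum /num_colored_partitions -sum1_card -natz natr_sum.
rewrite big_mkcond; apply: eq_bigr => m _; rewrite inE -expr_sum coefXn eq_sym.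
by case: eqP.
Qed.

(** Modulo ['X^(m.+1)] both [u] and the product [v] of truncated geometric sums are inverse to [P],
    because factors for sizes above [m] are 1 there. *)
Lemma num_colored_partitionsE (c : nat -> nat) (N m n : nat) (u : {poly int}) :
    (m < N)%N -> (m <= n)%N ->
    u * \prod_(k < n) (1 - 'X^(k.+1)) ^+ c k.+1 = 1 %[modX N] ->
  (num_colored_partitions c m)%:Z = u`_m.
Proof.
move=> ltmN lemn uP; rewrite num_colored_partitions_coef.
set v := \prod_x _; pose P : {poly int} := \prod_(k < m) (1 - 'X^(k.+1)) ^+ c k.+1.
have P0 : P`_0 = 1.
  rewrite coef0_prod big1 // => k _.
  by rewrite -horner_coef0 !hornerE expr0n subr0 expr1n.
have Pv : P * v = 1 %[modX m.+1].
  rewrite /P -prod_part_sizeE -big_split /=.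
  elim/big_ind: _ => // [p q p1 q1|x _]; first by rewrite p1 q1 mulr1.
  (* For a part of size [s >= 1], the product telescopes to [1 - 'X^(s * m.+1)]. *)
  under eq_bigr => j _ do rewrite mulnC exprM.
  rewrite -opprB mulNr -subrX1 opprB -exprM eqmodXn_Xn0 ?subr0 //.
  by rewrite /part_size; lia.
have Pu : P * u = 1 %[modX m.+1].
  have {}uP := eqmodXn_le ltmN uP; rewrite -[X in eqmodXn _ _ X]uP mulrC.
  rewrite (@eqmodXn_prod_trunc _ _ m n (fun k => (1 - 'X^(k.+1)) ^+ c k.+1)) // => k /andP[lemk _].
  by rewrite eqmodXn_Xn0 // subr0 expr1n.
suff [vu] : v = u %[modX m.+1] by apply: vu.
by apply: (@eqmodXn_mul2l _ m.+1 P) => //; rewrite Pv Pu.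
Qed.

(** Each block [i * t + 1, ..., i * t + t] meets the class of [r] exactly once, at [i * t + r]. *)
Lemma prod_residue {R : comNzRingType} (t r n : nat) (f : nat -> R) :
    (0 < r <= t)%N ->
  \prod_(k < n * t) f k.+1 ^+ (k.+1 == r %[mod t]) = \prod_(i < n) f (i * t + r)%N.
Proof.
move=> /andP[r0 lert]; rewrite -(big_mkord xpredT (fun k => f k.+1 ^+ (k.+1 == r %[mod t]))).
rewrite big_nat_mul big_mkord; apply: eq_bigr => i _.
rewrite -{1}[(i * t)%N]add0n big_addn mulSn addnK big_mkord.
have lt0 : (r.-1 < t)%N by lia.
rewrite (bigD1 (Ordinal lt0)) //= big1 ?mulr1.
  by rewrite -addSn prednK // addnC modnMDl eqxx expr1.
move=> j neqj; rewrite -addSn [(j.+1 + _)%N]addnC modnMDl.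
case: eqP => [modj | _]; last by rewrite expr0.
case/eqP: neqj; apply/val_inj => /=.
have ltj := ltn_ord j; have [ejt | nejt] := eqVneq j.+1 t.
  have [ert | nert] := eqVneq r t; first lia.
  by move: modj; rewrite ejt modnn modn_small; lia.
have [ert | nert] := eqVneq r t; first by move: modj; rewrite ert modnn modn_small; lia.
by move: modj; rewrite !modn_small; lia.
Qed.

(** The first [n] factors of [(q^r; q^t)_oo], with ['X] for [q]. *)
Definition arith_prod {R : comNzRingType} (n t r : nat) : {poly R} :=
  \prod_(k < n) (1 - 'X^(k * t + r)).

(* The first [n] factors of each half of the paper's $(q^{r\pm}; q^t)_\infty$. *)
Definition theta {R : comNzRingType} (n t r : nat) : {poly R} :=
  arith_prod n t r * arith_prod n t (t - r).

Lemma prod_pm_colors (t : nat) (s : seq (nat * nat)) (n : nat) :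
    all (fun rm => (0 < rm.1 < t)%N) s ->
  \prod_(k < n * t) (1 - 'X^(k.+1)) ^+ pm_colors t s k.+1 =
  \prod_(rm <- s) theta n t rm.1 ^+ rm.2 :> {poly int}.
Proof.
move=> /allP s_lt; under [LHS]eq_bigr => k _ do rewrite /pm_colors expr_sum.
rewrite exchange_big; rewrite big_seq [RHS]big_seq; apply: eq_bigr => -[r m] /s_lt /= r_lt.
under eq_bigr => k _ do rewrite /= [(m * _)%N]mulnC exprM exprD.
rewrite prodrXl big_split /= /theta /arith_prod; congr ((_ * _) ^+ _).
  by rewrite (prod_residue n (fun k => 1 - 'X^k)) //; lia.
rewrite -(prod_residue n (fun k => 1 - 'X^k)); last by lia.
apply: eq_bigr => k _; congr (_ ^+ (nat_of_bool _)).
by rewrite -[RHS](eqn_modDr r) subnK ?modnn ?mod0n //; lia.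
Qed.

(** * The triple product *)

Fixpoint qbinom {R : comNzRingType} (q : R) (m i : nat) : R :=
  match m, i with
  | _, 0 => 1
  | 0, _.+1 => 0
  | m'.+1, i'.+1 => qbinom q m' i'.+1 + q ^+ (m' - i') * qbinom q m' i'
  end.

Definition qpoch {R : comNzRingType} (q : R) (n : nat) : R :=
  \prod_(k < n) (1 - q ^+ k.+1).

Lemma qbinom0 {R : comNzRingType} (q : R) (m : nat) : qbinom q m 0 = 1.
Proof. by case: m. Qed.

Lemma qbinom_small {R : comNzRingType} (q : R) (m i : nat) :
  (m < i)%N -> qbinom q m i = 0.
Proof.
elim: m i => [|m IHm] [|i] //= lti.
by rewrite !IHm ?mulr0 ?addr0 //; lia.
Qed.

Lemma qpochS {R : comNzRingType} (q : R) (n : nat) :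
  qpoch q n.+1 = qpoch q n * (1 - q ^+ n.+1).
Proof. exact: big_ord_recr. Qed.

(** The quotient formula with denominators cleared. The Pascal rule matches the splitting [1 -
    q^(m+1) = (1 - q^(m-i)) + q^(m-i) (1 - q^(i+1))]. *)
Lemma qpoch_qbinom {R : comNzRingType} (q : R) (m i : nat) :
  (i <= m)%N -> qpoch q i * qpoch q (m - i) * qbinom q m i = qpoch q m.
Proof.
elim: m i => [|m IHm] [|i] lei //=.
- by rewrite /qpoch !big_ord0 !mulr1.
- by rewrite subn0 mulr1 /qpoch big_ord0 mul1r.
have {lei} := lei; rewrite ltnS subSS leq_eqVlt => /predU1P[->|lti].
  rewrite subnn qbinom_small ?ltnSn // add0r expr0 mul1r.
  by rewrite !qpochS -[in RHS](IHm m) // subnn; ring.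
have IH1 := IHm _ lti; have IH2 := IHm i (ltnW lti).
have Ep : qpoch q (m - i) = qpoch q (m - i.+1) * (1 - q ^+ (m - i)).
  by rewrite -(subnSK lti) qpochS.
have Eq : q ^+ m.+1 = q ^+ (m - i) * q ^+ i.+1 by rewrite -exprD; congr (_ ^+ _); lia.
have ->: qpoch q i.+1 * qpoch q (m - i) *
   (qbinom q m i.+1 + q ^+ (m - i) * qbinom q m i) =
  (1 - q ^+ (m - i)) * (qpoch q i.+1 * qpoch q (m - i.+1) * qbinom q m i.+1) +
  q ^+ (m - i) * (1 - q ^+ i.+1) * (qpoch q i * qpoch q (m - i) * qbinom q m i).
  by rewrite Ep [qpoch q i.+1]qpochS; ring.
by rewrite IH1 IH2 qpochS Eq; ring.
Qed.

(** The q-binomial theorem, by induction with the Pascal rule. The second variable [y] keeps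
    exponents nonnegative when the product is recentred below. *)
Lemma Rothe {R : comNzRingType} (q x y : R) (m : nat) :
  \prod_(k < m) (y + x * q ^+ k) =
  \sum_(i < m.+1) qbinom q m i * q ^+ 'C(i, 2) * x ^+ i * y ^+ (m - i).
Proof.
elim: m => [|m IHm]; first by rewrite big_ord0 big_ord1 /= !mulr1.
rewrite big_ord_recr /= {}IHm mulrDr !mulr_suml.
rewrite big_ord_recl [RHS]big_ord_recl /= !qbinom0.
rewrite [X in _ + _ + X]big_ord_recr [X in _ = _ + X]big_ord_recr /=.
rewrite /bump /= !add1n !add0n (qbinom_small _ (ltnSn m)) add0r subSS subnn.
rewrite !subn0 -!addrA; congr (_ + _); first by rewrite exprSr mulrA.
rewrite !addrA; congr (_ + _); last first.
  by rewrite binS bin1 exprD exprSr !expr0; ring.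
rewrite -big_split; apply: eq_bigr => i _ /=.
rewrite !add1n !add0n subSS binS bin1.
have ->: (m - i = (m - i.+1).+1)%N by have := ltn_ord i; lia.
have ->: q ^+ m = q ^+ (m - i.+1).+1 * q ^+ i.
  by rewrite -exprD; congr (_ ^+ _); have := ltn_ord i; lia.
by rewrite !exprS exprD; ring.
Qed.

(** * The Jacobi triple product, finite and truncated *)

Definition int_range (n : nat) : seq int := [seq i%:Z - n%:Z | i <- iota 0 n.*2.+1].

Lemma mem_int_range (n : nat) (j : int) : (j \in int_range n) = (`|j| <= n)%N.
Proof.
apply/mapP/idP => [[i]|lej].
  by rewrite mem_iota => /andP[_ lti] ->; lia.
exists (absz (j + n%:Z)); first by rewrite mem_iota; lia.
lia.
Qed.

Lemma int_range_uniq (n : nat) : uniq (int_range n).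
Proof. by rewrite map_inj_uniq ?iota_uniq // => i j; lia. Qed.

(** Equal to [2u * j(j-1)/2 + a j], the exponent in the triple product with base [q^(2u)] and
    argument [q^a], written without halves. *)
Definition theta_exp (u a : nat) (j : int) : int :=
  u%:Z * j ^+ 2 + (a%:Z - u%:Z) * j.

(** Stands for [e^j q^(theta_exp u a j)]. The absolute values are harmless: [e] will satisfy
    [e * e = 1], and the exponent is nonnegative by [theta_exp_ge0]. *)
Definition theta_term {R : comNzRingType} (e : R) (u a : nat) (j : int) : {poly R} :=
  e%:P ^+ absz j * 'X^(absz (theta_exp u a j)).

Lemma theta_exp_ge0 (u a b : nat) (j : int) :
  (a + b = u.*2)%N -> 0 <= theta_exp u a j.
Proof. by rewrite /theta_exp => abu; have [j0 | j0] := lerP 0 j; nia. Qed.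

Lemma bin2_double (k : nat) : 'C(k, 2).*2%:Z = k%:Z * (k%:Z - 1).
Proof. by elim: k => // k; rewrite binS bin1; lia. Qed.

(* [Rothe] with [q = X^(2u)], [x = e X^a], [y = X^(2un)] and [m = 2n]; the first
   half of the factors is turned around by means of [e^2 = 1]. *)
Lemma finite_triple_product {R : comNzRingType} (e : R) (u a b n : nat) :
    e * e = 1 -> (a + b = u.*2)%N ->
  \prod_(k < n) (1 + e%:P * 'X^(k * u.*2 + a)) *
    \prod_(k < n) (1 + e%:P * 'X^(k * u.*2 + b)) =
  \sum_(j <- int_range n)
    qbinom 'X^(u.*2) n.*2 (absz (j + n%:Z)) * theta_term e u a j.
Proof.
move=> ee abu; set A := \prod_(k < n) _; set B := \prod_(k < n) _.
set t := u.*2; pose E : {poly R} := e%:P.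
have EE : E * E = 1 by rewrite /E -polyCM ee.
(* [E ^+ n * 'X^w] is the monomial that turns the two products into the one expanded by [Rothe]. It
   can be cancelled, since [E] is its own inverse and ['X^w] is monic. *)
pose w := (t * n * n + (a * n + t * 'C(n, 2)))%N.
have regW : GRing.lreg (E ^+ n * 'X^w).
  apply: lregM; last exact/monic_lreg/monicXn.
  by apply: lregX => p q /(congr1 ( *%R E)); rewrite !mulrA EE !mul1r.
apply: regW.
have E1 : \prod_(k < n) (E * 'X^(a + t * k)) = E ^+ n * 'X^(a * n + t * 'C(n, 2)).
  elim: (n) => [|k IHk]; first by rewrite big_ord0 bin0n !muln0 !mulr1.
  rewrite big_ord_recr /= IHk binS bin1 exprSr mulrACA -exprD.
  by congr (_ * 'X^_); nia.
have -> : E ^+ n * 'X^w * (A * B) =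
    \prod_(k < n + n) ('X^(t * n) + E * 'X^a * 'X^t ^+ k).
  rewrite big_split_ord /=.
  have -> : \prod_(k < n) ('X^(t * n) + E * 'X^a * 'X^t ^+ k) =
      \prod_(k < n) (E * 'X^(a + t * k)) * B.
    have -> : B = \prod_(k < n) (1 + E * 'X^((n - k.+1) * t + b)).
      by rewrite /B (reindex_inj rev_ord_inj).
    rewrite -big_split /=.
    (* Since [a + b = t], the exponents [a + t k] and [(n - k - 1) t + b] add up to [t n]. *)
    apply: eq_bigr => k _; rewrite mulrDr mulr1 mulrACA EE mul1r -exprD addrC.
    rewrite -mulrA -exprM -exprD; congr (_ + 'X^_).
    by have := ltn_ord k; rewrite -/t; nia.
  have -> : \prod_(k < n) ('X^(t * n) + E * 'X^a * 'X^t ^+ (n + k)) =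
      'X^(t * n * n) * A.
    have -> : 'X^(t * n * n) = \prod_(k < n) 'X^(t * n) :> {poly R}.
      by rewrite prodr_const card_ord exprM.
    rewrite -big_split /=.
    apply: eq_bigr => k _; rewrite mulrDr mulr1 -mulrA -exprM -exprD -/E.
    rewrite [_ * (E * _)]mulrCA -exprD.
    by congr (_ + E * 'X^_); rewrite -/t; nia.
  by rewrite E1 /w exprD; ring.
rewrite Rothe mulr_sumr big_map (_ : iota 0 n.*2.+1 = index_iota 0 n.*2.+1) ?big_mkord ?addnn; last first.
  by rewrite /index_iota subn0.
apply: eq_bigr => i _; have := ltn_ord i; rewrite ltnS => lei.
rewrite subrK /theta_term -/E.
have -> : E ^+ n * 'X^w * (qbinom 'X^t n.*2 i * (E ^+ absz (i%:Z - n%:Z) *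
   'X^(absz (theta_exp u a (i%:Z - n%:Z))))) =
  qbinom 'X^t n.*2 i * (E ^+ n * E ^+ absz (i%:Z - n%:Z)) *
   'X^(w + absz (theta_exp u a (i%:Z - n%:Z))).
  by rewrite exprD; ring.
have -> : E ^+ n * E ^+ absz (i%:Z - n%:Z) = E ^+ i.
  rewrite -exprD; have [leni | ltin] := leqP n i; first by congr (_ ^+ _); lia.
  have -> : (n + absz (i%:Z - n%:Z) = i + 2 * (n - i))%N by lia.
  by rewrite exprD exprM expr2 EE expr1n mulr1.
rewrite exprMn -!exprM.
have -> : (w + absz (theta_exp u a (i%:Z - n%:Z)) =
    t * 'C(i, 2) + a * i + t * n * (n.*2 - i))%N.
  have x_ge0 := theta_exp_ge0 (i%:Z - n%:Z) abu.
  have Ei : (n.*2 - i)%N%:Z = n%:Z + n%:Z - i%:Z by lia.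
  have Et : t%:Z = u%:Z + u%:Z by rewrite /t; lia.
  have tC k : t%:Z * 'C(k, 2)%:Z = u%:Z * (k%:Z * (k%:Z - 1)).
    by rewrite -bin2_double Et; lia.
  apply/eqP; rewrite -eqz_nat /w !PoszD gez0_abs // /theta_exp !PoszM !tC Ei Et.
  by apply/eqP; ring.
by rewrite !exprD; ring.
Qed.

(** Ensures that terms with [|j| > n] vanish modulo ['X^(n.+1)]. *)
Lemma theta_exp_ge (u a b : nat) (j : int) :
  (a + b = u.*2)%N -> (0 < a)%N -> (0 < b)%N -> (absz j <= absz (theta_exp u a j))%N.
Proof.
move=> abu a0 b0; have := theta_exp_ge0 j abu; rewrite /theta_exp.
by have [j0 | j0] := lerP 0 j; nia.
Qed.

Lemma qpoch_trunc {R : comNzRingType} (t m m' : nat) :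
    (0 < t)%N -> (m <= m')%N ->
  (qpoch 'X^t m' : {poly R}) = qpoch 'X^t m %[modX m.+1].
Proof.
move=> t0 lemm'; apply: (eqmodXn_prod_trunc (f := fun k => 1 - 'X^t ^+ k.+1)) => //.
by move=> k /andP[lemk _]; rewrite -exprM eqmodXn_Xn0 ?subr0 //; nia.
Qed.

Lemma qpoch_coef0 {R : comNzRingType} (t m : nat) :
  (0 < t)%N -> (qpoch 'X^t m : {poly R})`_0 = 1.
Proof.
move=> t0; rewrite coef0_prod big1 // => k _.
by rewrite -exprM coefB coef1 coefXn [(0 == t * _)%N]ltn_eqF ?muln_gt0 ?t0 //= subr0.
Qed.

(** As [i], [m - i] and [m] are all at least [l], the three [qpoch] factors in [qpoch_qbinom] agree
    modulo ['X^(l.+1)] and can be cancelled. *)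
Lemma qpoch_mul_qbinom {R : comNzRingType} (t m i l : nat) :
    (0 < t)%N -> (l <= i)%N -> (i + l <= m)%N ->
  (qpoch 'X^t m * qbinom 'X^t m i : {poly R}) = 1 %[modX l.+1].
Proof.
move=> t0 leli leilm; apply: (@eqmodXn_mul2l _ _ (qpoch 'X^t m)).
  exact: qpoch_coef0.
rewrite mulr1 mulrA -[X in eqmodXn _ _ X](@qpoch_qbinom _ _ m i); last by lia.
rewrite (@qpoch_trunc _ t l m) ?(@qpoch_trunc _ t l i)
  ?(@qpoch_trunc _ t l (m - i)) //; lia.
Qed.

(** The weight of term [j] is 1 only to precision [n - |j| + 1], but [theta_term] carries a power of
    ['X] of exponent at least [|j|]. *)
Lemma triple_product {R : comNzRingType} (e : R) (u a b n : nat) :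
    e * e = 1 -> (a + b = u.*2)%N -> (0 < a)%N -> (0 < b)%N ->
  qpoch 'X^(u.*2) n.*2 * (\prod_(k < n) (1 + e%:P * 'X^(k * u.*2 + a)) *
    \prod_(k < n) (1 + e%:P * 'X^(k * u.*2 + b))) =
  \sum_(j <- int_range n) theta_term e u a j %[modX n.+1].
Proof.
move=> ee abu a0 b0; rewrite finite_triple_product // mulr_sumr.
apply: eqmodXn_sum => j; rewrite mem_int_range => lejn _; rewrite /theta_term.
have -> (p q r s : {poly R}) : p * (q * (r * s)) = r * (s * (p * q)) by ring.
rewrite -[X in eqmodXn _ _ (_ * X)]mulr1; apply: eqmodXn_mul => //.
have lejx := theta_exp_ge j abu a0 b0.
apply/eqmodXn_mulXn/(@eqmodXn_le _ _ (n - absz j).+1); first by lia.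
by have [j0 | j0] := lerP 0 j; apply: qpoch_mul_qbinom; lia.
Qed.

(** * Dissection of a lattice sum by parity *)

Lemma eqmodXn_sum_subset {R : comNzRingType} (N : nat) (I : eqType) (r s : seq I)
    (F : I -> {poly R}) :
    uniq r -> uniq s -> {subset r <= s} ->
    (forall i, i \notin r -> F i = 0 %[modX N]) ->
  \sum_(i <- s) F i = \sum_(i <- r) F i %[modX N].
Proof.
move=> uniq_r uniq_s rs F0; rewrite (bigID (mem r)) /=.
rewrite -[X in X + _]big_filter (perm_big r) /=; last first.
  apply: uniq_perm; rewrite ?filter_uniq // => i.
  by rewrite mem_filter andb_idr // => /rs.
rewrite -[X in eqmodXn _ _ X]addr0; apply: eqmodXn_add => //.
elim/big_ind: _ => // p q p0 q0.
by rewrite p0 q0 addr0.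
Qed.

Lemma mulr_sum_pairs {R : comNzRingType} (I : Type) (r : seq I) (F G : I -> R) :
  (\sum_(i <- r) F i) * (\sum_(i <- r) G i) =
  \sum_(x <- [seq (i, j) | i <- r, j <- r]) F x.1 * G x.2.
Proof. by rewrite big_distrlr big_allpairs. Qed.

Lemma expr_absz_add {R : comNzRingType} (e : R) (i j : int) :
  e * e = 1 -> e ^+ absz i * e ^+ absz j = e ^+ absz (i + j).
Proof.
move=> ee; have eE k : e ^+ k = e ^+ odd k.
  by rewrite -{1}[k]odd_double_half exprD -mul2n exprM expr2 ee expr1n mulr1.
by rewrite -exprD eE [RHS]eE; congr (e ^+ nat_of_bool _); lia.
Qed.

(* Both squares are sums over the lattice of all [(s, d)], the first over the
   points with [s] and [d] of the same parity, the second over the others. *)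
Lemma theta_squares {R : comNzRingType} (n : nat) :
  let T e u a : {poly R} := \sum_(j <- int_range n) theta_term e u a j in
  T (-1) 38 39 ^+ 2 - 'X^18 * T (-1) 38 1 ^+ 2 = T (-1) 19 20 * T 1 19 19
    %[modX n.+1].
Proof.
move=> T; rewrite !expr2 /T !mulr_sum_pairs.
set box := [seq _ | i <- _, j <- _].
have box_uniq : uniq box by rewrite allpairs_uniq ?int_range_uniq // => -[? ?] [? ?] _ _ [-> ->].
have mem_box p : (p \in box) = (absz p.1 <= n)%N && (absz p.2 <= n)%N.
  case: p => s d; apply/allpairsP/andP => /= [[[s' d'] /= [hs hd [-> ->]]]|[hs hd]].
    by rewrite -!mem_int_range.
  by exists (s, d); rewrite !mem_int_range.
move: box box_uniq mem_box => box box_uniq mem_box.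
pose F (p : int * int) : {poly R} := theta_term (-1) 19 20 p.1 * theta_term 1 19 19 p.2.
(* The coordinates are the sum and the difference of the two indices. In [h2] the shift by 1 absorbs
   ['X^18], as [19 (s+1)^2 - 37 (s+1) + 18 = 19 s^2 + s], and reverses the sign. *)
pose h1 (p : int * int) : int * int := (p.1 + p.2, p.1 - p.2).
pose h2 (p : int * int) : int * int := (p.1 + p.2 - 1, p.1 - p.2).
have NN : (-1) * (-1) = 1 :> R by ring.
have NNP : (-1)%:P * (-1)%:P = 1 :> {poly R} by rewrite -polyCM NN.
have FE p k : (theta_exp 19 20 p.1 + theta_exp 19 19 p.2 = k%:Z) ->
    F p = (-1)%:P ^+ absz p.1 * 'X^k.
  move=> pk; rewrite /F /theta_term expr1n mul1r -mulrA -exprD; congr (_ * 'X^_).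
  have := @theta_exp_ge0 19 20 18 p.1 erefl.
  by have := @theta_exp_ge0 19 19 19 p.2 erefl; lia.
have F1 p : theta_term (-1) 38 39 p.1 * theta_term (-1) 38 39 p.2 = F (h1 p).
  rewrite /theta_term mulrACA expr_absz_add // -exprD (@FE (h1 p)
    (absz (theta_exp 38 39 p.1) + absz (theta_exp 38 39 p.2))) //.
  rewrite PoszD !gez0_abs; try exact: (@theta_exp_ge0 38 39 37).
  by rewrite /theta_exp /h1 /=; ring.
have F2 p : 'X^18 * (theta_term (-1) 38 1 p.1 * theta_term (-1) 38 1 p.2) = - F (h2 p).
  rewrite /theta_term [X in _ * X]mulrACA expr_absz_add // -exprD mulrCA -exprD.
  rewrite (@FE (h2 p) (18 + (absz (theta_exp 38 1 p.1) + absz (theta_exp 38 1 p.2)))).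
    rewrite -mulNr; congr (_ * _).
    have <- := @expr_absz_add _ (-1)%:P (p.1 + p.2) (-1) NNP.
    by rewrite expr1 polyCN; ring.
  rewrite !PoszD !gez0_abs; try exact: (@theta_exp_ge0 38 1 75).
  by rewrite /theta_exp /h2 /=; ring.
rewrite mulr_sumr -sumrN.
have -> : \sum_(p <- box) theta_term (-1) 38 39 p.1 * theta_term (-1) 38 39 p.2 =
    \sum_(p <- map h1 box) F p by rewrite big_map; apply: eq_bigr.
have -> : \sum_(p <- box) - ('X^18 * (theta_term (-1) 38 1 p.1 * theta_term (-1) 38 1 p.2)) =
    \sum_(p <- map h2 box) F p.
  by rewrite big_map; apply: eq_bigr => p _; rewrite F2 opprK.
(* The two images together cover the box without repetition; where they overrun it, [F] vanishes
   modulo ['X^(n.+1)]. *)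
rewrite -big_cat; apply: eqmodXn_sum_subset => //.
- rewrite cat_uniq !map_inj_uniq ?box_uniq ?andbT /=.
  + by apply/hasPn => _ /mapP[p _ ->]; apply/mapP => -[p' _ []]; lia.
  + by move=> [? ?] [? ?] [? ?]; congr (_, _); lia.
  + by move=> [? ?] [? ?] [? ?]; congr (_, _); lia.
- move=> [s d]; rewrite mem_box mem_cat /= => /andP[les led].
  case: (boolP (odd (absz (s + d)))) => sd; apply/orP; [right | left]; apply/mapP.
    exists (((s + 1 + d) %/ 2)%Z, ((s + 1 - d) %/ 2)%Z); last first.
      by rewrite /h2 /=; congr (_, _); lia.
    by rewrite mem_box /=; lia.
  exists (((s + d) %/ 2)%Z, ((s - d) %/ 2)%Z); last by rewrite /h1 /=; congr (_, _); lia.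
  by rewrite mem_box /=; lia.
move=> p; rewrite mem_box negb_and -!ltnNge => pn.
have ge1 := @theta_exp_ge 19 20 18 p.1 erefl isT isT.
have ge2 := @theta_exp_ge 19 19 19 p.2 erefl isT isT.
rewrite /F /theta_term mulrACA -exprD eqmodXn_Xn0 ?mulr0 //.
case/orP: pn => [/leq_trans/(_ ge1) lt1 | /leq_trans/(_ ge2) lt2].
  exact: leq_trans (leq_addr _ _).
exact: leq_trans (leq_addl _ _).
Qed.

(** * The theta function identity *)

Lemma theta_triple_product {R : comNzRingType} (n u a : nat) :
    (0 < a < u.*2)%N ->
  (qpoch 'X^(u.*2) n.*2 * theta n (u.*2) a : {poly R}) =
  \sum_(j <- int_range n) theta_term (-1) u a j %[modX n.+1].
Proof.
move=> /andP[a0 lta].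
have -> : theta n (u.*2) a = \prod_(k < n) (1 + (-1)%:P * 'X^(k * u.*2 + a)) *
    \prod_(k < n) (1 + (-1)%:P * 'X^(k * u.*2 + (u.*2 - a))) :> {poly R}.
  by rewrite /theta /arith_prod polyCN; congr (_ * _); apply: eq_bigr => k _; rewrite mulN1r.
by apply: triple_product; rewrite ?mulrNN ?mulr1 //; lia.
Qed.

Lemma arith_prod_coef0 {R : comNzRingType} (n t r : nat) :
  (0 < r)%N -> (arith_prod n t r : {poly R})`_0 = 1.
Proof.
move=> r0; rewrite coef0_prod big1 // => k _.
by rewrite coefB coef1 coefXn [(0 == _ + r)%N]ltn_eqF ?subr0 //; lia.
Qed.

Lemma prod_double {R : comNzRingType} (n : nat) (f : nat -> R) :
  \prod_(k < n.*2) f k = \prod_(k < n) f k.*2 * \prod_(k < n) f k.*2.+1.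
Proof.
elim: n => [|n IHn]; first by rewrite !big_ord0 mulr1.
by rewrite doubleS !big_ord_recr /= IHn; ring.
Qed.

(** Splits the index by parity. It is only a congruence because the right side has twice as many
    factors, the extra ones being 1 modulo ['X^(n.+1)]. *)
Lemma arith_prod_double {R : comNzRingType} (n t r : nat) :
    (0 < t)%N -> (0 < r)%N ->
  (arith_prod n t r : {poly R}) =
  arith_prod n t.*2 r * arith_prod n t.*2 (t + r) %[modX n.+1].
Proof.
move=> t0 r0.
transitivity (arith_prod n.*2 t r : {poly R}).
  symmetry; apply: (eqmodXn_prod_trunc (f := fun k => 1 - 'X^(k * t + r))).
    by rewrite -addnn leq_addr.
  by move=> k /andP[lenk _]; rewrite eqmodXn_Xn0 ?subr0 //; nia.
rewrite /arith_prod (prod_double n (fun k => 1 - 'X^(k * t + r))).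
have -> : \prod_(k < n) (1 - 'X^(k.*2 * t + r)) =
    \prod_(k < n) (1 - 'X^(k * t.*2 + r)) :> {poly R}.
  by apply: eq_bigr => k _; rewrite -doubleMl doubleMr.
have -> // : \prod_(k < n) (1 - 'X^(k.*2.+1 * t + r)) =
    \prod_(k < n) (1 - 'X^(k * t.*2 + (t + r))) :> {poly R}.
by apply: eq_bigr => k _; congr (1 - 'X^_); lia.
Qed.

Lemma qpoch_arith_prod {R : comNzRingType} (n t : nat) :
  qpoch 'X^t n = arith_prod n t t :> {poly R}.
Proof. by apply: eq_bigr => k _; rewrite -exprM mulnS addnC mulnC. Qed.

Lemma theta_identity {R : comNzRingType} (n : nat) :
  let th r : {poly R} := theta n 76 r in
  th 37%N ^+ 2 * th 19%N ^+ 2 - 'X^18 * th 1%N ^+ 2 * th 19%N ^+ 2 =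
  th 18%N * th 20%N * th 38%N ^+ 2 %[modX n.+1].
Proof.
move=> th; pose P t r : {poly R} := arith_prod n t r.
(* Truncates [(-q^19; q^38)_oo]; the triple product with [e = 1] yields its square, as
   [19 = 38 - 19]. *)
pose S : {poly R} := \prod_(k < n) (1 + 'X^(k * 38 + 19)).
have thE r : th r = P 76%N r * P 76%N (76 - r)%N by [].
have PE t r : (0 < t)%N -> (0 < r)%N -> P t r = P t.*2 r * P t.*2 (t + r)%N %[modX n.+1].
  exact: arith_prod_double.
pose E76 : {poly R} := qpoch 'X^76 n.*2; pose E38 : {poly R} := qpoch 'X^38 n.*2.
have E38E : E38 = P 76%N 38%N * E76 %[modX n.+1].
  rewrite /E38 /E76 !(@qpoch_trunc _ _ n n.*2) -?addnn ?leq_addr //.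
  by rewrite !qpoch_arith_prod; apply: PE.
have SP : P 38%N 19%N * S = P 76%N 38%N.
  rewrite -big_split; apply: eq_bigr => k _ /=.
  by rewrite -subr_sqr expr1n -exprM; congr (1 - 'X^_); lia.
have C : theta n 38 20 = th 18%N * th 20%N %[modX n.+1].
  rewrite -[theta n 38 20]/(P 38%N 20%N * P 38%N 18%N) !thE.
  rewrite (PE 38%N 20%N) // (PE 38%N 18%N) //=.
  by rewrite -[(38 + 20)%N]/58%N -[(38 + 18)%N]/56%N; apply: eq_eqmodXn; ring.
have th19 : th 19%N = P 38%N 19%N %[modX n.+1].
  by rewrite (PE 38%N 19%N).
have key : E76 ^+ 2 * (th 37%N ^+ 2 - 'X^18 * th 1%N ^+ 2) =
    E38 ^+ 2 * theta n 38 20 * S ^+ 2 %[modX n.+1].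
  have := @theta_squares R n; rewrite /=.
  rewrite -(@theta_triple_product _ n 38 39) // -(@theta_triple_product _ n 38 1) //.
  rewrite -(@theta_triple_product _ n 19 20) //.
  rewrite -(@triple_product _ 1 19 19 19 n) ?mulr1 //.
  rewrite -[19.*2]/38%N -[38.*2]/76%N -/E38 -/E76.
  have -> : theta n 76 39 = th 37%N by rewrite thE mulrC.
  have -> : \prod_(k < n) (1 + 1%:P * 'X^(k * 38 + 19)) = S.
    by apply: eq_bigr => k _; rewrite mul1r.
  move=> H; rewrite (_ : E76 ^+ 2 * _ = (E76 * th 37%N) ^+ 2 - 'X^18 * (E76 * th 1%N) ^+ 2).
    by rewrite H; apply: eq_eqmodXn; ring.
  by ring.
apply: (@eqmodXn_mul2l _ _ (E76 ^+ 2)).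
  by rewrite expr2 coef0M qpoch_coef0 ?mulr1.
have -> : E76 ^+ 2 * (th 37%N ^+ 2 * th 19%N ^+ 2 - 'X^18 * th 1%N ^+ 2 * th 19%N ^+ 2) =
  E76 ^+ 2 * (th 37%N ^+ 2 - 'X^18 * th 1%N ^+ 2) * th 19%N ^+ 2 by ring.
(* The right side becomes [E76^2 th(18) th(20)] times the fourth power of [P 38 19 * S = P 76 38],
   and [th(38)] is the square of the latter. *)
rewrite key C th19 E38E.
have -> : th 38%N = (P 38%N 19%N * S) ^+ 2 by rewrite thE SP expr2.
by rewrite -SP; apply: eq_eqmodXn; ring.
Qed.

(** * Passage to the generating functions *)

Lemma eqmodXn_inv {R : comNzRingType} (N : nat) (p : {poly R}) :
  p`_0 = 1 -> exists u, u * p = 1 %[modX N].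
Proof.
(* The inverse is the geometric series in [1 - p], whose constant term is 0. *)
move=> p0; have d0 k : (1 - p) ^+ k = 0 %[modX k].
  elim: k => [|k [IHk]]; split=> // i lti; rewrite exprS coef0 coefM big1 // => -[[|j] ltj] _ /=.
    by rewrite coefB coef1 p0 subrr mul0r.
  by rewrite IHk ?coef0 ?mulr0 //; lia.
exists (\sum_(k < N) (1 - p) ^+ k).
have -> : (\sum_(k < N) (1 - p) ^+ k) * p = 1 - (1 - p) ^+ N.
  rewrite -[1 - (1 - p) ^+ N]opprB subrX1; ring.
by rewrite d0 subr0.
Qed.

Theorem theorem5p1 (n : nat) (hn : (18 <= n)%N) :
  (K1 n)%:Z - (K2 (n - 18)%N)%:Z - (K3 n)%:Z = 0.
Proof.
(* Opaque, so that [ring] and [coef0M] treat each theta product as an atom. *)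
have [th thE] : {th : nat -> {poly int} | forall r, th r = theta n 76 r} by eexists.
have th0 r : (0 < r < 76)%N -> (th r)`_0 = 1.
  by move=> r0; rewrite thE coef0M !arith_prod_coef0 ?mulr1 //; lia.
(* One inverse [v] of the product of all theta factors serves for all three series: [u1], [u2], [u3]
   multiply it by the factors absent from the respective denominator. *)
have [|v vE] := @eqmodXn_inv _ n.+1 (th 1%N ^+ 2 * th 37%N ^+ 2 * th 18%N * th 20%N *
  th 38%N ^+ 2 * th 19%N ^+ 2); first by rewrite !expr2 !coef0M !th0 // !mulr1.
pose u1 := v * (th 37%N ^+ 2 * th 19%N ^+ 2).
pose u2 := v * (th 1%N ^+ 2 * th 19%N ^+ 2).
pose u3 := v * (th 18%N * th 20%N * th 38%N ^+ 2).
have KE s m u : all (fun rm => (0 < rm.1 < 76)%N) s -> (m <= n)%N ->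
    u * \prod_(rm <- s) th rm.1 ^+ rm.2 = 1 %[modX n.+1] ->
    (num_colored_partitions (pm_colors 76 s) m)%:Z = u`_m.
  move=> s_lt lemn; under eq_bigr => rm _ do rewrite thE.
  rewrite -prod_pm_colors // => uE.
  by apply: num_colored_partitionsE uE; lia.
rewrite (KE _ n u1) // ?(KE _ (n - 18)%N u2) // ?(KE _ n u3) ?leq_subr //.
(* The hypothesis [18 <= n] makes the truncated subtraction a genuine shift by ['X^18]. *)
- have -> : u2`_(n - 18) = ('X^18 * u2)`_n by rewrite coefXnM ltnNge hn.
  rewrite -!coefB -[RHS](coef0 _ n).
  suff [] : u1 - 'X^18 * u2 - u3 = 0 %[modX n.+1] by apply.
  have -> : u1 - 'X^18 * u2 - u3 = v * (th 37%N ^+ 2 * th 19%N ^+ 2 -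
    'X^18 * th 1%N ^+ 2 * th 19%N ^+ 2 - th 18%N * th 20%N * th 38%N ^+ 2).
    by rewrite /u1 /u2 /u3; ring.
  by have := @theta_identity int n; rewrite /= -!thE => ->; rewrite subrr mulr0.
- by rewrite -[X in eqmodXn _ _ X]vE !big_cons big_nil; apply: eq_eqmodXn; rewrite /u3 /=; ring.
- by rewrite -[X in eqmodXn _ _ X]vE !big_cons big_nil; apply: eq_eqmodXn; rewrite /u2 /=; ring.
- by rewrite -[X in eqmodXn _ _ X]vE !big_cons big_nil; apply: eq_eqmodXn; rewrite /u1 /=; ring.
Qed.
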